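(* Let $M$ be a real smooth $n$-dimensional manifold, let $S$ be an arbitrary semispray on $T^2M$ and let $L:T^2M\to\mathbb{R}$ be a second order Lagrangian. Its Cartan-Poincaré one-forms $\theta_L^1,\theta_L^2$ and two-forms $\omega_L^1=d\theta_L^1$, $\omega_L^2=d\theta_L^2$ satisfy: (1) $d_J\theta_L^2=d_Jd_{J^2}L=0$ and $d_{J^2}\theta_L^1=d_{J^2}d_JL=0$; (2) $i_S\theta_L^1=\theta_L^1(S)={\mathbb C}_2(L)$ and $i_S\theta_L^2=\theta_L^2(S)={\mathbb C}_1(L)$; (3) $\mathcal{L}_S\theta_L^1=i_S\omega_L^1+d({\mathbb C}_2(L))$ and $\mathcal{L}_S\theta_L^2=i_S\omega_L^2+d({\mathbb C}_1(L))$.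
   Context: $T^2M$ is the second order tangent bundle (2-jets at $0$ of curves in $M$). A chart $(x^i)$ on $M$ induces coordinates $(x^i,y^{(1)i},y^{(2)i})$ on $T^2M$ by $y^{(\alpha)i}(j^2_0\rho)=\frac{1}{\alpha!}\frac{d^\alpha(x^i\circ\rho)}{dt^\alpha}\big|_{t=0}$, $\alpha=1,2$. All objects are smooth; the summation convention is used. Tangent structure: $J=\frac{\partial}{\partial y^{(1)i}}\otimes dx^i+\frac{\partial}{\partial y^{(2)i}}\otimes dy^{(1)i}$, an endomorphism of $TT^2M$. Liouville vector fields: ${\mathbb C}_2=y^{(1)i}\frac{\partial}{\partial y^{(1)i}}+2y^{(2)i}\frac{\partial}{\partial y^{(2)i}}$ and ${\mathbb C}_1=J({\mathbb C}_2)=y^{(1)i}\frac{\partial}{\partial y^{(2)i}}$. A semispray is a global vector field $S$ on $T^2M$ with $JS={\mathbb C}_2$. A second order Lagrangian is a function $L:T^2M\to\mathbb{R}$. Cartan-Poincaré one-forms: $\theta_L^1=d_JL=dL\circ J=\frac{\partial L}{\partial y^{(1)i}}dx^i+\frac{\partial L}{\partial y^{(2)i}}dy^{(1)i}$, $\theta_L^2=d_{J^2}L=dL\circ J^2=\frac{\partial L}{\partial y^{(2)i}}dx^i$. Convention: for $K\in\{J,J^2\}$, $d_Kf=df\circ K$ on functions, and for a one-form $\theta$, $d_K\theta$ is the two-form $(d_K\theta)(X,Y)=d\theta(KX,KY)$. $\mathcal{L}_S$ is the Lie derivative and $i_S$ the interior product. *)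

(* Defs.v *)
From HB Require Import structures.
From mathcomp Require Import all_boot all_order all_algebra.
From mathcomp Require Import all_classical all_reals all_analysis.

Set Implicit Arguments.
Unset Strict Implicit.
Unset Printing Implicit Defensive.

Import Order.TTheory GRing.Theory Num.Theory.
Import numFieldNormedType.Exports.

Local Open Scope classical_set_scope.
Local Open Scope ring_scope.

(* C^k on an open set U of a finite-dimensional space V. *)
Fixpoint Ck (R : realType) (V W : normedModType R) (k : nat) (U : set V)
    (f : V -> W) : Prop :=
  match k with
  | 0%N => forall x, U x -> {for x, continuous f}
  | k'.+1 => (forall x, U x -> differentiable f x) /\
             (forall v, Ck k' U (fun x => 'D_v f x))
  end.

Definition smooth (R : realType) (V W : normedModType R) (U : set V)
  (f : V -> W) : Prop := forall k, Ck k U f.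

(* The atlas [idx] need not be maximal, but may be. The functions [chart c]
   and [param c] are only meaningful on [dom c] and [chart c @` dom c]. *)
Record manifold (R : realType) (n : nat) := Manifold {
  points :> topologicalType;
  idx : Type;
  dom : idx -> set points;
  chart : idx -> points -> 'rV[R]_n;
  param : idx -> 'rV[R]_n -> points;
  points_hausdorff : hausdorff_space points;
  points_second_countable : @second_countable points;
  dom_open : forall c, open (dom c);
  dom_cover : forall p, exists c, dom c p;
  image_open : forall c, open (chart c @` dom c);
  chartK : forall c p, dom c p -> param c (chart c p) = p;
  chart_continuous : forall c, {within dom c, continuous (chart c)};
  param_continuous : forall c,
    {within chart c @` dom c, continuous (param c)};
  transition_smooth : forall c c',
    smooth (chart c @` (dom c `&` dom c')) (chart c' \o param c)
}.

(* A point of the coordinate space of T^2M is a matrix y whose entry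
   y a i is the coordinate y^(a)i, with y^(0)i = x^i. *)
Notation jetsp R n := 'M[R]_(3, n).

Definition i0 : 'I_3 := @Ordinal 3 0 isT.
Definition i1 : 'I_3 := @Ordinal 3 1 isT.
Definition i2 : 'I_3 := @Ordinal 3 2 isT.

Definition taylor2 (R : realType) (n : nat) (g : R -> 'rV[R]_n) : jetsp R n :=
  \matrix_(a < 3, i < n) ((a`!)%:R^-1 * derive1n a (fun t => g t ord0 i) 0).

Section SecondOrderTangentBundle.
Context (R : realType) (n : nat) (M : manifold R n).

(* Only the germ of the curve at 0 is meaningful. *)
Record curve := Curve {
  curve_fun :> R -> M;
  curve_smooth : forall c, dom c (curve_fun 0) ->
    exists U : set R, [/\ open U, U 0, (forall t, U t -> dom c (curve_fun t))
                        & smooth U (chart c \o curve_fun)]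
}.

Definition jet_eq (r s : curve) : Prop :=
  r 0 = s 0 /\
  forall c, dom c (r 0) -> taylor2 (chart c \o r) = taylor2 (chart c \o s).

Record T2 := Jet {
  jet_class : set curve;
  jet_classP : exists r : curve, jet_class = [set s | jet_eq r s]
}.

Definition jet_repr (z : T2) : curve := projT1 (cid (jet_classP z)).

Definition T2_dom (c : idx M) : set T2 := [set z | dom c (jet_repr z 0)].

Definition T2_coord (c : idx M) (z : T2) : jetsp R n :=
  taylor2 (chart c \o jet_repr z).

Definition T2_image (c : idx M) : set (jetsp R n) :=
  [set y | (chart c @` dom c) (row i0 y)].

(* The expression of g in the coordinates induced by c, i.e. the composite of
   g with the inverse of T2_coord c, with the value 0 outside T2_image c. *)
Definition local (V : nmodType) (c : idx M) (g : T2 -> V) : jetsp R n -> V :=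
  fun y => xget 0 (g @` [set z | T2_dom c z /\ T2_coord c z = y]).

Definition smooth_on_T2 (f : T2 -> R) : Prop :=
  forall c, smooth (T2_image c) (local c f).

(* Tensor fields on T^2M are given by their components in each induced chart,
   as functions of the coordinates: functions (field0), 1-forms (field1),
   2-forms (field2) and fields of endomorphisms of TT^2M (endo). Tangent vectors
   are likewise given by their components, an element of jetsp R n. *)
Definition field0 := idx M -> jetsp R n -> R.
Definition field1 := idx M -> jetsp R n -> jetsp R n -> R.
Definition field2 := idx M -> jetsp R n -> jetsp R n -> jetsp R n -> R.
Definition endo := idx M -> jetsp R n -> jetsp R n -> jetsp R n.

Definition fun0 (f : T2 -> R) : field0 := fun c => local c f.

(* Component functions are only meaningful on the images of the charts. *)
Definition eq_T2 (A : Type) (f g : idx M -> jetsp R n -> A) : Prop :=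
  forall c y, T2_image c y -> f c y = g c y.

Record vector_field := VectorField {
  vf :> idx M -> jetsp R n -> jetsp R n;
  vf_smooth : forall c, smooth (T2_image c) (vf c);
  vf_compat : forall c c' z, T2_dom c z -> T2_dom c' z ->
    vf c' (T2_coord c' z) =
    'd (local c (T2_coord c')) (T2_coord c z) (vf c (T2_coord c z))
}.

Definition d0 (f : field0) : field1 := fun c y u => 'd (f c) y u.

(* dt(X, Y) = X(t(Y)) - Y(t(X)) - t([X, Y]), on the vector fields with constant
   components u and v, whose bracket vanishes. *)
Definition d1 (t : field1) : field2 := fun c y u v =>
  'D_u (fun y' => t c y' v) y - 'D_v (fun y' => t c y' u) y.

Definition vf_apply (X : idx M -> jetsp R n -> jetsp R n) (f : field0) :
  field0 := fun c y => d0 f c y (X c y).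

Definition interior1 (X : idx M -> jetsp R n -> jetsp R n) (t : field1) :
  field0 := fun c y => t c y (X c y).

Definition interior2 (X : idx M -> jetsp R n -> jetsp R n) (w : field2) :
  field1 := fun c y u => w c y (X c y) u.

(* (L_X t)(Y) = X(t(Y)) - t([X, Y]), where [X, Y] = - D_u X for the vector field
   Y with constant components u; in components, X^k d_k t_i + t_k d_i X^k. *)
Definition Lie1 (X : idx M -> jetsp R n -> jetsp R n) (t : field1) : field1 :=
  fun c y u => 'D_(X c y) (fun y' => t c y' u) y + t c y ('D_u (X c) y).

Definition dK0 (K : endo) (f : field0) : field1 := fun c y u =>
  d0 f c y (K c y u).

Definition dK1 (K : endo) (t : field1) : field2 := fun c y u v =>
  d1 t c y (K c y u) (K c y v).

(* [delta_mx i1 i] and [delta_mx i2 i] are the coordinate vector fields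
   d/dy^(1)i and d/dy^(2)i. *)
Definition J : endo := fun c y u =>
  \sum_(i < n) (u i0 i *: delta_mx i1 i + u i1 i *: delta_mx i2 i).

Definition J2 : endo := fun c y u => J c y (J c y u).

Definition C2 (c : idx M) (y : jetsp R n) : jetsp R n :=
  \sum_(i < n) (y i1 i *: delta_mx i1 i + (2 * y i2 i) *: delta_mx i2 i).

Definition C1 (c : idx M) (y : jetsp R n) : jetsp R n := J c y (C2 c y).

Definition is_semispray (S : vector_field) : Prop :=
  eq_T2 (fun c y => J c y (S c y)) C2.

Definition theta1 (L : T2 -> R) : field1 := dK0 J (fun0 L).
Definition theta2 (L : T2 -> R) : field1 := dK0 J2 (fun0 L).

Definition omega1 (L : T2 -> R) : field2 := d1 (theta1 L).
Definition omega2 (L : T2 -> R) : field2 := d1 (theta2 L).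

Definition add1 (s t : field1) : field1 := fun c y u => s c y u + t c y u.
Definition zero2 : field2 := fun c y u v => 0.

End SecondOrderTangentBundle.

Arguments J {R n M}.
Arguments J2 {R n M}.
Arguments C1 {R n M}.
Arguments C2 {R n M}.
Arguments zero2 {R n M}.

(* Main.v *)
Require Import Defs.
From HB Require Import structures.
From mathcomp Require Import all_boot all_order all_algebra.
From mathcomp Require Import all_classical all_reals all_analysis.

(* In an induced chart J is constant, linear, and J^3 = 0, which gives (1); (2)
   is J S = C2. For (3), with K = J or J^2, Cartan's formula
   L_S theta = i_S d theta + d (i_S theta) reduces to the product rule for
   y |-> dL_y (K (S y)), obtained by expanding dL_y in partial derivatives, since
   its Leibniz term dL_y (K (D_u S)) is exactly the theta (D_u S) of L_S. *)

Set Implicit Arguments.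
Unset Strict Implicit.
Unset Printing Implicit Defensive.

Import Order.TTheory GRing.Theory Num.Theory.
Import numFieldNormedType.Exports.

Local Open Scope classical_set_scope.
Local Open Scope ring_scope.

(** ['d f x] is picked by [get] from the continuous linear maps that give a first order expansion of
    [f] at [x]. This predicate sees only the germ of [f], so both choices are made from the same
    predicate. *)
Lemma near_eq_diff (R : numFieldType) (V W : normedModType R) (f g : V -> W)
    (x u : V) : {near x, f =1 g} -> 'd f x u = 'd g x u.
Proof.
(* The expansion inside [diff] is centred at [lim (nbhs x)], which is [x]. Passing from [h] to [k]
   keeps the value at [x] and, near [x], the remainder. *)
have imp (h k : V -> W) (A : {linear V -> W}) : {near x, h =1 k} ->
    (forall z, h z = h (lim (nbhs x)) + A (z - lim (nbhs x))
                     +o_(z \near x) (z - lim (nbhs x))) ->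
    (forall z, k z = k (lim (nbhs x)) + A (z - lim (nbhs x))
                     +o_(z \near x) (z - lim (nbhs x))).
  move=> hk hA; have {}hA : h = (cst (h x) + (fun z => A (z - x))) +o_x (center x).
    by apply/funext => z; have := hA z; rewrite lim_id.
  have kA : k = (cst (k x) + (fun z => A (z - x))) +o_x (center x).
    move/eqaddoP: hA => hA; apply/eqaddoP => e e0; have := hA e e0.
    by apply: filter_app; near=> z; rewrite !fctE (nbhs_singleton hk) (near hk z).
  by move=> z; rewrite lim_id //; have := congr1 (@^~ z) kA.
move=> fg; rewrite /diff; congr (GRing.Linear.sort (get _) u).
apply/funext => A; apply/propext.
split=> -[cA dA]; split=> //; first exact: imp dA.
by apply: imp dA; near do apply/esym.
Unshelve. all: by end_near. Qed.

(** By finite dimension, [f] is a finite sum of coordinate functions times fixed vectors. *)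
Lemma linear_mx_differentiable (R : realFieldType) (m n : nat)
    (W : normedModType R) (f : {linear 'M[R]_(m, n) -> W}) (x : 'M[R]_(m, n)) :
  differentiable f x.
Proof.
have -> : (f : _ -> _) =
    \sum_(i < m) \sum_(j < n) (fun z : 'M[R]_(m, n) => z i j *: f (delta_mx i j)).
  apply/funext => z; rewrite fct_sumE {1}[z]matrix_sum_delta linear_sum.
  apply: eq_bigr => i _; rewrite fct_sumE linear_sum.
  by apply: eq_bigr => j _; rewrite linearZ.
apply: differentiable_sum => i; apply: differentiable_sum => j.
exact/differentiableZl/differentiable_coord.
Qed.

Lemma linear_mx_continuous (R : realFieldType) (m n : nat)
    (W : normedModType R) (f : {linear 'M[R]_(m, n) -> W}) : continuous f.
Proof. by move=> x; exact/differentiable_continuous/linear_mx_differentiable. Qed.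

Lemma derive_linear_mx (R : realFieldType) (m n : nat) (V W : normedModType R)
    (f : {linear 'M[R]_(m, n) -> W}) (g : V -> 'M[R]_(m, n)) (x v : V) :
  differentiable g x -> 'D_v (f \o g) x = f ('D_v g x).
Proof.
move=> dg; have df := linear_mx_differentiable f (g x).
rewrite !deriveE//; last exact: differentiable_comp.
by rewrite diff_comp //= diff_lin //; exact: linear_mx_continuous.
Qed.

Lemma diff_mx_sum (R : realFieldType) (m n : nat) (f : 'M[R]_(m, n) -> R)
    (x z : 'M[R]_(m, n)) : differentiable f x ->
  'd f x z = \sum_(i < m) \sum_(j < n) z i j * 'D_(delta_mx i j) f x.
Proof.
move=> df; rewrite [in LHS](matrix_sum_delta z) linear_sum; apply: eq_bigr => i _.
by rewrite linear_sum; apply: eq_bigr => j _; rewrite linearZ /= -deriveE.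
Qed.

Lemma diff_pairing (R : realFieldType) (m n : nat) (f : 'M[R]_(m, n) -> R)
    (Z : 'M[R]_(m, n) -> 'M[R]_(m, n)) (x u : 'M[R]_(m, n)) :
    (\near x, differentiable f x) ->
    (forall v, differentiable ('D_v f) x) -> differentiable Z x ->
  'd (fun y => 'd f y (Z y)) x u =
  'D_u (fun y => 'd f y (Z x)) x + 'd f x ('D_u Z x).
Proof.
move=> df ddf dZ; have dfx := nbhs_singleton df.
(* [G Y] is the pairing of the differential of [f] with [Y], written as a sum of products of scalar
   functions so that the Leibniz rule applies. It is used for [Y = Z] and for the constant field
   [Z x], whose Leibniz term vanishes. *)
pose G (Y : 'M[R]_(m, n) -> 'M[R]_(m, n)) := \sum_(i < m) \sum_(j < n)
  ((fun y => Y y i j) * ('D_(delta_mx i j) f)).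
have GE (Y : 'M[R]_(m, n) -> 'M[R]_(m, n)) : {near x, (fun y => 'd f y (Y y)) =1 G Y}.
  near=> y; rewrite diff_mx_sum; last exact: (near df y).
  by rewrite /G fct_sumE; apply: eq_bigr => i _; rewrite fct_sumE.
have dcoord (Y : 'M[R]_(m, n) -> 'M[R]_(m, n)) i j :
    differentiable Y x -> differentiable (fun y => Y y i j) x.
  move=> dY; have := differentiable_coord (Y x) i j.
  exact: (@differentiable_comp _ _ _ _ Y (fun N => N i j)).
have dG Y : differentiable Y x -> differentiable (G Y) x.
  move=> dY; apply: differentiable_sum => i; apply: differentiable_sum => j.
  exact/differentiableM/ddf/dcoord.
have DG Y : differentiable Y x -> 'D_u (G Y) x =
    \sum_(i < m) \sum_(j < n) Y x i j * 'D_u ('D_(delta_mx i j) f) x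
    + 'd f x ('D_u Y x).
  move=> dY; rewrite diff_mx_sum // derive_mx; last exact: diff_derivable.
  rewrite -big_split /= derive_sum => [|i]; last first.
    apply: derivable_sum => j.
    exact/diff_derivable/differentiableM/ddf/dcoord.
  apply: eq_bigr => i _; rewrite -big_split /= derive_sum => [|j]; last first.
    exact/diff_derivable/differentiableM/ddf/dcoord.
  apply: eq_bigr => j _; rewrite deriveM; last 2 first.
  - exact/diff_derivable/dcoord.
  - exact/diff_derivable/ddf.
  by rewrite mxE; congr (_ + _); rewrite mulrC.
have dcstZ : differentiable (cst (Z x) : 'M[R]_(m, n) -> 'M[R]_(m, n)) x.
  exact: differentiable_cst.
transitivity ('D_u (G Z) x).
  by rewrite (deriveE u (dG Z dZ)); exact: (near_eq_diff u (GE Z)).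
rewrite (DG Z dZ).
rewrite (near_eq_derive u (GE (cst (Z x)))) (DG _ dcstZ).
by rewrite derive_cst linear0 addr0.
Unshelve. all: by end_near. Qed.

Section TangentStructure.
Context (R : realType) (n : nat) (M : manifold R n).
Implicit Types (c : idx M) (y u : jetsp R n).

Lemma J_is_linear c y : linear (J c y).
Proof.
move=> k u v; rewrite /J scaler_sumr -big_split; apply: eq_bigr => i _ /=.
by rewrite !mxE !scalerDl scalerDr !scalerA addrACA.
Qed.

(** The base point 0 is a placeholder: [J c y] is convertible to [J c 0] for every [y]. *)
Definition Jlin c : {linear jetsp R n -> jetsp R n} :=
  HB.pack (J c 0) (GRing.isLinear.Build _ _ _ _ _ (J_is_linear c 0)).

Lemma J_entry c y u a i :
  J c y u a i = (a == i1)%:R * u i0 i + (a == i2)%:R * u i1 i.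
Proof.
rewrite /J summxE (bigD1 i) //= big1 => [|j /negPf ji]; rewrite !mxE.
  by rewrite eqxx !andbT addr0 [_ * u i0 i]mulrC [_ * u i1 i]mulrC.
by rewrite (eq_sym i) ji !andbF !mulr0 addr0.
Qed.

(** [J] shifts the three rows down by one and drops the last. The base points differ because [d1]
    moves the point while the vector [K c y u] stays frozen. *)
Lemma J_nilpotent c y y' y'' u : J c y (J c y' (J c y'' u)) = 0.
Proof.
by apply/matrixP => a i; rewrite !J_entry !mxE /= !(mul0r, mulr0, addr0, add0r).
Qed.

Lemma T2_image_open c : open (T2_image c).
Proof.
apply: (@open_comp _ _ (row i0 : jetsp R n -> 'rV[R]_n)); last exact: image_open.
move=> y _.
exact: (@linear_mx_continuous R 3 n _ (row i0 : {linear jetsp R n -> 'rV[R]_n})).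
Qed.

(** Common form of both identities in (3): [K] has constant components in each chart, and [K], [Y]
    are [J], [C2] or [J2], [C1]. *)
Lemma Lie1_dK0 (S : vector_field M) (Y : idx M -> jetsp R n -> jetsp R n)
    (L : T2 M -> R) (K : idx M -> {linear jetsp R n -> jetsp R n}) :
    smooth_on_T2 L -> eq_T2 (fun c y => K c (S c y)) Y ->
  let theta := dK0 (fun c _ => K c) (fun0 L) in
  eq_T2 (Lie1 S theta)
    (add1 (interior2 S (d1 theta)) (d0 (vf_apply Y (fun0 L)))).
Proof.
move=> hL SY theta c y cy; apply/funext => u.
have nearT : \near y, T2_image c y.
  by apply: open_nbhs_nbhs; split; [exact: T2_image_open|exact: cy].
have dS : differentiable (S c) y by have [/(_ y cy)] := vf_smooth S c 1.
have dKS : differentiable (K c \o S c) y.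
  exact/differentiable_comp/linear_mx_differentiable.
pose f := local c L.
have df : \near y, differentiable f y.
  by apply: filterS nearT => z cz; have [/(_ z cz)] := hL c 1.
have ddf v : differentiable ('D_v f) y.
  by have [_ /(_ v) [/(_ y cy)]] := hL c 2.
have dYL : d0 (vf_apply Y (fun0 L)) c y u =
    'D_u (fun z => 'd f z (K c (S c y))) y + 'd f y (K c ('D_u (S c) y)).
  transitivity ('d (fun z => 'd f z ((K c \o S c) z)) y u).
    (* [Y] agrees with [K] applied to [S] only on the chart image; since that set is open, this
       suffices for the differential at [y]. *)
    by apply: near_eq_diff; apply: filterS nearT => z cz; rewrite /vf_apply -SY.
  apply: etrans (diff_pairing u df ddf dKS) _; congr (_ + 'd f y _).
  exact: derive_linear_mx.
have cancel (a b d e : R) : e = b + d -> a + d = a - b + e.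
  by move=> ->; rewrite addrA subrK.
exact: cancel dYL.
Qed.

End TangentStructure.

Theorem proposition3p1 (R : realType) (n : nat) (M : manifold R n)
    (S : vector_field M) (hS : is_semispray S)
    (L : T2 M -> R) (hL : smooth_on_T2 L) :
  ((eq_T2 (dK1 J (theta2 L)) (dK1 J (dK0 J2 (fun0 L))) /\
    eq_T2 (dK1 J (dK0 J2 (fun0 L))) zero2) /\
   (eq_T2 (dK1 J2 (theta1 L)) (dK1 J2 (dK0 J (fun0 L))) /\
    eq_T2 (dK1 J2 (dK0 J (fun0 L))) zero2)) /\
  ((eq_T2 (interior1 S (theta1 L)) (fun c y => theta1 L c y (S c y)) /\
    eq_T2 (fun c y => theta1 L c y (S c y)) (vf_apply C2 (fun0 L))) /\
   (eq_T2 (interior1 S (theta2 L)) (fun c y => theta2 L c y (S c y)) /\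
    eq_T2 (fun c y => theta2 L c y (S c y)) (vf_apply C1 (fun0 L)))) /\
  (eq_T2 (Lie1 S (theta1 L))
     (add1 (interior2 S (omega1 L)) (d0 (vf_apply C2 (fun0 L)))) /\
   eq_T2 (Lie1 S (theta2 L))
     (add1 (interior2 S (omega2 L)) (d0 (vf_apply C1 (fun0 L))))).
Proof.
have hS2 : eq_T2 (fun c y => J2 c y (S c y)) C1.
  by move=> c y cy; rewrite /J2 (hS c y cy).
(* Both terms of [d1] differentiate the one-form on a vector in the image of [K], which [K'] kills
   at every point: they are derivatives of the zero function. *)
have dK1_0 (K K' : endo M) : (forall c y y' u, K' c y (K c y' u) = 0) ->
    eq_T2 (dK1 K (dK0 K' (fun0 L))) zero2.
  move=> KK0 c y _; apply/funext => u; apply/funext => v.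
  rewrite /dK1 /d1 /dK0 /d0 /zero2.
  under eq_fun do rewrite KK0 linear0.
  under [X in _ - 'D__ X _]eq_fun do rewrite KK0 linear0.
  by rewrite !derive_cst subrr.
split; [split; split=> //; apply: dK1_0 => *; exact: J_nilpotent|split].
  split; split=> // c y cy.
    by rewrite /theta1 /dK0 (hS c y cy).
  by rewrite /theta2 /dK0 (hS2 c y cy).
split; first exact: (@Lie1_dK0 _ _ _ S C2 L (@Jlin _ _ M)).
exact: (@Lie1_dK0 _ _ _ S C1 L (fun c => Jlin c \o Jlin c)).
Qed.
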